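(* Let $A\in\mathbb{C}^{n\times n}$ have index $k$ and let $m$ be a positive integer. Then the $m$-weak group MP inverse of $A$ satisfies $$A^{\mathrm{w}_m,\dagger}=A^{\mathrm{w}_m}P_A .$$ If moreover $A$ is written in its core-EP decomposition $$A=U\begin{bmatrix}T&S\\0&N\end{bmatrix}U^*,$$ with $U\in\mathbb{C}^{n\times n}$ unitary, $T\in\mathbb{C}^{t\times t}$ nonsingular, $t=r(A^k)$, and $N$ nilpotent of index $k$, then $$A^{\mathrm{w}_m,\dagger}=U\begin{bmatrix}T^{-1}&T^{-(m+1)}T_mNN^\dagger\\0&0\end{bmatrix}U^*,$$ where $T_m=\sum_{j=0}^{m-1}T^jSN^{m-1-j}$.
   Context: $r(\cdot)$ denotes rank, $(\cdot)^*$ conjugate transpose, $A^\dagger$ the Moore-Penrose inverse, $A^D$ the Drazin inverse, and $P_A=AA^\dagger$ the orthogonal projector onto the range of $A$. The index of $A\in\mathbb{C}^{n\times n}$ is the smallest nonnegative integer $k$ with $r(A^{k+1})=r(A^k)$ (with $A^0=I_n$). For $A$ of index $k$, the core-EP inverse is $A^{\mathrm{cEP}}=A^DA^k(A^k)^\dagger$ and the $m$-weak group inverse is $A^{\mathrm{w}_m}=(A^{\mathrm{cEP}})^{m+1}A^m$. The $m$-weak group MP inverse ($m$-WGMP inverse) $A^{\mathrm{w}_m,\dagger}$ is the unique $X\in\mathbb{C}^{n\times n}$ satisfying $XAX=X$, $AX=A_1A^\dagger$ and $XA=A^DA_1$, where $A_1=AA^{\mathrm{w}_m}A$. Every $A\in\mathbb{C}^{n\times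 n}$ of index $k$ admits a core-EP decomposition of the form displayed in the claim. *)

(* Defs.v *)
From HB Require Import structures.
From mathcomp Require Import all_boot all_order all_algebra.

Set Implicit Arguments.
Unset Strict Implicit.
Unset Printing Implicit Defensive.

Import Order.TTheory GRing.Theory Num.Theory.
Local Open Scope ring_scope.
Local Open Scope sesquilinear_scope.

Section Index.
Variable F : fieldType.

Lemma rank_powS n (A : 'M[F]_n) k : (\rank (A ^+ k.+1) <= \rank (A ^+ k))%N.
Proof. by rewrite exprS mxrankM_maxr. Qed.

Lemma rank_pow_stable n (A : 'M[F]_n) :
  exists k, \rank (A ^+ k.+1) == \rank (A ^+ k).
Proof.
suff H b k : (\rank (A ^+ k) <= b)%N ->
    exists j, \rank (A ^+ j.+1) == \rank (A ^+ j).
  exact: (H _ 0 (leqnn _)).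
elim: b k => [|b IHb] k hk.
  by exists k; rewrite eqn_leq rank_powS (leq_trans hk).
have [e|ne] := eqVneq (\rank (A ^+ k.+1)) (\rank (A ^+ k)).
  by exists k; apply/eqP.
apply: (IHb k.+1); rewrite -ltnS; apply: leq_trans hk.
by rewrite ltn_neqAle ne rank_powS.
Qed.

Definition mxindex n (A : 'M[F]_n) : nat := ex_minn (rank_pow_stable A).

(* For k = 0 this forces n = 0, since N ^+ 0 is the identity. *)
Definition nilpotent_of_index n (N : 'M[F]_n) (k : nat) : Prop :=
  N ^+ k = 0 /\ forall j, (j < k)%N -> N ^+ j != 0.

Definition is_drazin n (A X : 'M[F]_n) : bool :=
  [&& X *m A *m X == X,
      A *m X == X *m A
    & X *m A ^+ (mxindex A).+1 == A ^+ mxindex A].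

Lemma rank_pow_index n (A : 'M[F]_n) j :
  \rank (A ^+ (mxindex A + j)) = \rank (A ^+ mxindex A).
Proof.
rewrite /mxindex; case: ex_minnP => k /eqP hk _.
have [V hV] : exists V, A ^+ k = V *m A ^+ k.+1.
  apply/submxP; have := mxrank_leqif_sup (submxMl A (A ^+ k)).
  rewrite (_ : A *m _ = A ^+ k.+1); last by rewrite exprS mulmxE.
  by case=> _ <-; rewrite hk.
elim: j => [|j IHj]; first by rewrite addn0.
apply/eqP; rewrite -IHj addnS eqn_leq rank_powS /=.
have -> : A ^+ (k + j) = V *m A ^+ (k + j).+1.
  by rewrite exprD {1}hV -addSn exprD -!mulmxE mulmxA.
exact: mxrankM_maxr.
Qed.

Lemma drazin_exists n (A : 'M[F]_n) : exists X, is_drazin A X.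
Proof.
pose k := mxindex A; pose q := (k + k.+1)%N; pose B := A ^+ q.
have rB : \rank B = \rank (A ^+ k) by apply: rank_pow_index.
have qE : B = A ^+ k.+1 *m A ^+ k by rewrite /B /q addnC exprD mulmxE.
have qE' : B = A ^+ k *m A ^+ k.+1 by rewrite /B /q exprD mulmxE.
have [V' hV'] : exists V, A ^+ k = V *m B.
  apply/submxP; have := mxrank_leqif_sup (submxMl (A ^+ k.+1) (A ^+ k)).
  by rewrite -qE => -[_ <-]; rewrite rB.
have [V hV] : exists V, A ^+ k = B *m V.
  suff /submxP[W hW] : ((A ^+ k)^T <= B^T)%MS.
    by exists W^T; apply: trmx_inj; rewrite trmx_mul trmxK.
  have := mxrank_leqif_sup (submxMl (A ^+ k.+1)^T (A ^+ k)^T).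
  by rewrite -trmx_mul -qE' => -[_ <-]; rewrite !mxrank_tr rB.
have [G BGB] : exists G, B *m G *m B = B by exists (pinvmx B); rewrite mulmxKpV.
pose X := A ^+ k *m G *m A ^+ k.
have AkS : A ^+ k.+1 = A *m A ^+ k by rewrite exprS mulmxE.
have AkS' : A ^+ k.+1 = A ^+ k *m A by rewrite exprSr mulmxE.
have AB : A *m B = B *m A by rewrite /B !mulmxE -exprS -exprSr.
have AX : A *m X = A ^+ k.+1 *m V.
  rewrite /X; have -> : A *m (A ^+ k *m G *m A ^+ k) =
      A *m V' *m (B *m G *m B) *m V by rewrite {1}hV' {1}hV !mulmxA.
  by rewrite BGB -(mulmxA A V') -hV' -AkS.
have XA : X *m A = V' *m A ^+ k.+1.
  rewrite /X; have -> : A ^+ k *m G *m A ^+ k *m A =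
      V' *m (B *m G *m B) *m V *m A by rewrite {1}hV' {1}hV !mulmxA.
  by rewrite BGB -(mulmxA V') -hV -(mulmxA V') -AkS'.
have VV : A ^+ k.+1 *m V = V' *m A ^+ k.+1.
  have -> : V' *m A ^+ k.+1 = V' *m (A *m B) *m V.
    by rewrite AkS [in LHS]hV !mulmxA.
  by rewrite AB mulmxA -hV' -AkS'.
exists X; apply/and3P; split; apply/eqP.
- by rewrite XA {1}/X !mulmxA -(mulmxA V') -qE -hV'.
- by rewrite AX XA VV.
- by rewrite -/k AkS mulmxA XA -mulmxA -qE -hV'.
Qed.

Definition drazin n (A : 'M[F]_n) : 'M[F]_n := xchoose (drazin_exists A).

Lemma drazin_unique n (A X Y : 'M[F]_n) :
  is_drazin A X -> is_drazin A Y -> X = Y.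
Proof.
move=> /and3P[/eqP X1 /eqP X2 /eqP X3] /and3P[/eqP Y1 /eqP Y2 /eqP Y3].
set k := mxindex A in X3 Y3.
have powX j : X = X ^+ j.+1 *m A ^+ j.
  elim: j => [|j IHj]; first by rewrite expr0 expr1 mulmx1.
  rewrite -[LHS]X1 -mulmxA X2 mulmxA {1}IHj exprS [in RHS]exprS.
  rewrite -!mulmxE -!mulmxA; congr (_ *m _).
  have cXA : A ^+ j *m X = X *m A ^+ j.
    by rewrite !mulmxE; apply/esym/commrX; rewrite /GRing.comm -!mulmxE X2.
  rewrite (mulmxA (A ^+ j)) cXA !mulmxA.
  by rewrite mulmxE -exprSr -mulmxE -mulmxA mulmxE -exprSr.
have powY j : Y = A ^+ j *m Y ^+ j.+1.
  elim: j => [|j IHj]; first by rewrite expr0 expr1 mul1mx.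
  have cYA : A ^+ j *m Y = Y *m A ^+ j.
    by rewrite !mulmxE; apply/esym/commrX; rewrite /GRing.comm -!mulmxE Y2.
  rewrite -[LHS]Y1 -Y2 -mulmxA {2}IHj (mulmxA Y) -cYA !mulmxA.
  rewrite mulmxE -exprS -mulmxE -mulmxA.
  by congr (_ *m _); rewrite mulmxE -exprS.
have XAY : X *m A *m Y = Y.
  rewrite {2}(powY k) -{1}X3 -!mulmxA; congr (_ *m _).
  by rewrite exprS -mulmxE -mulmxA -powY.
have cY : A ^+ k *m A *m Y = A ^+ k.
  by rewrite -mulmxA Y2 mulmxA -[in LHS](_ : Y *m A ^+ k *m A = A ^+ k *m Y *m A);
     [rewrite -mulmxA mulmxE -exprSr -mulmxE Y3
     |congr (_ *m _); rewrite !mulmxE; apply: commrX; rewrite /GRing.comm -!mulmxE Y2].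
have XAY' : X *m A *m Y = X.
  rewrite {1}(powX k) -!mulmxA (mulmxA (A ^+ k)) cY.
  by rewrite -powX.
by rewrite -XAY' XAY.
Qed.

End Index.

Section Inverses.
Variable C : numClosedFieldType.

Definition is_mpinv m n (A : 'M[C]_(m, n)) (X : 'M[C]_(n, m)) : bool :=
  [&& A *m X *m A == A,
      X *m A *m X == X,
      (A *m X)^t* == A *m X
    & (X *m A)^t* == X *m A].

Lemma trCmx_mul m n p (A : 'M[C]_(m, n)) (B : 'M[C]_(n, p)) :
  (A *m B)^t* = B^t* *m A^t*.
Proof. by rewrite trmx_mul map_mxM. Qed.

Lemma gram_unit m n (A : 'M[C]_(m, n)) : row_free A -> A *m A^t* \in unitmx.
Proof.
move=> fA; rewrite -row_free_unit -kermx_eq0; apply/eqP/row_matrixP => i.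
rewrite row0; set u := row i _; apply: (row_free_inj fA); rewrite mul0mx.
apply/eqP; apply: contraT => uA0; have := dotmx_is_dotmx uA0.
rewrite dotmxE trCmx_mul mulmxA -(mulmxA u) /u -row_mul mulmx_ker row0 mul0mx.
by rewrite mxE ltxx.
Qed.

Lemma mpinv_exists m n (A : 'M[C]_(m, n)) : exists X, is_mpinv A X.
Proof.
have [r [F [G [FG fF fG]]]] : exists r (F : 'M[C]_(m, r)) (G : 'M[C]_(r, n)),
    [/\ F *m G = A, row_full F & row_free G].
  exists (\rank A), (col_base A), (row_base A).
  by rewrite mulmx_base row_base_free col_base_full.
have uG : G *m G^t* \in unitmx by rewrite gram_unit.
have uF : F^t* *m F \in unitmx.
  have := @gram_unit _ _ (F^t* ) _; rewrite trmxCK; apply.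
  by rewrite /row_free mxrank_map mxrank_tr.
have hinv p (M : 'M[C]_p) : M^t* = M -> (invmx M)^t* = invmx M.
  by move=> hM; rewrite trmx_inv map_invmx hM.
have GG : (G *m G^t* )^t* = G *m G^t* by rewrite trCmx_mul trmxCK.
have FF : (F^t* *m F)^t* = F^t* *m F by rewrite trCmx_mul trmxCK.
pose GI := G^t* *m invmx (G *m G^t* ); pose FI := invmx (F^t* *m F) *m F^t*.
have GGI : G *m GI = 1%:M by rewrite /GI mulmxA mulmxV.
have FIF : FI *m F = 1%:M by rewrite /FI -mulmxA mulVmx.
have AX : A *m (GI *m FI) = F *m FI by rewrite -FG mulmxA -(mulmxA F) GGI mulmx1.
have XA : GI *m FI *m A = GI *m G.
  by rewrite -FG mulmxA -(mulmxA GI) FIF mulmx1.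
exists (GI *m FI); apply/and4P; split; apply/eqP.
- by rewrite AX -FG mulmxA -(mulmxA F) FIF mulmx1.
- by rewrite XA mulmxA -(mulmxA GI) GGI mulmx1.
- by rewrite AX /FI !trCmx_mul trmxCK hinv // !mulmxA.
- by rewrite XA /GI !trCmx_mul trmxCK hinv // !mulmxA.
Qed.

(* The system defining mpinv (and likewise drazin, wgmp) has exactly one
   solution, cf. mpinv_unique, so xchoose picks that one. *)
Definition mpinv m n (A : 'M[C]_(m, n)) : 'M[C]_(n, m) :=
  xchoose (mpinv_exists A).

Lemma mpinv_unique m n (A : 'M[C]_(m, n)) (X Y : 'M[C]_(n, m)) :
  is_mpinv A X -> is_mpinv A Y -> X = Y.
Proof.
move=> /and4P[/eqP X1 /eqP X2 /eqP X3 /eqP X4].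
move=> /and4P[/eqP Y1 /eqP Y2 /eqP Y3 /eqP Y4].
have AXY : A *m X = A *m Y.
  by rewrite -X3 -{1}Y1 -mulmxA trCmx_mul X3 Y3 mulmxA X1.
have XYA : X *m A = Y *m A.
  by rewrite -X4 -{1}Y1 -(mulmxA A) mulmxA trCmx_mul X4 Y4 -mulmxA (mulmxA A) X1.
by rewrite -X2 -mulmxA AXY mulmxA XYA Y2.
Qed.

Variable n : nat.
Implicit Types (A X : 'M[C]_n) (m : nat).

Definition orthproj A : 'M[C]_n := A *m mpinv A.

Definition coreEP A : 'M[C]_n :=
  drazin A *m A ^+ mxindex A *m mpinv (A ^+ mxindex A).

Definition weakgroup m A : 'M[C]_n := coreEP A ^+ m.+1 *m A ^+ m.

Definition is_wgmp m A X : bool :=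
  let A1 := A *m weakgroup m A *m A in
  [&& X *m A *m X == X,
      A *m X == A1 *m mpinv A
    & X *m A == drazin A *m A1].

Lemma wgmp_unique m A X Y : is_wgmp m A X -> is_wgmp m A Y -> X = Y.
Proof.
move=> /and3P[/eqP X1 /eqP X2 /eqP X3] /and3P[/eqP Y1 /eqP Y2 /eqP Y3].
by rewrite -X1 -mulmxA X2 -Y2 mulmxA X3 -Y3 Y1.
Qed.

Lemma wgmp_exists m A : exists X, is_wgmp m A X.
Proof.
have /and3P[/eqP D1 /eqP D2 /eqP D3] : is_drazin A (drazin A).
  exact: (xchooseP (drazin_exists A)).
have /and4P[/eqP M1 /eqP M2 _ _] : is_mpinv A (mpinv A).
  exact: (xchooseP (mpinv_exists A)).
set k := mxindex A in D3 *; set D := drazin A in D1 D2 D3 *.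
have /and4P[/eqP B1 /eqP B2 _ _] : is_mpinv (A ^+ k) (mpinv (A ^+ k)).
  exact: (xchooseP (mpinv_exists (A ^+ k))).
pose P := A ^+ k *m mpinv (A ^+ k); pose E := coreEP A.
have EE : E = D *m P by rewrite /E /coreEP -/k -/D /P mulmxA.
have DAk : D *m A ^+ k = A ^+ k *m D.
  by rewrite !mulmxE; apply: commrX; rewrite /GRing.comm -!mulmxE D2.
have AE : A *m E = P.
  by rewrite EE mulmxA D2 /P mulmxA -(mulmxA D) mulmxE -exprS -mulmxE D3.
have PE : P *m E = E.
  by rewrite EE {2 3}/P !(mulmxA D) DAk !mulmxA B1.
have EP : E *m P = E by rewrite EE /P !mulmxA -(mulmxA D (A ^+ k)) -(mulmxA D) B1.
have DAE : D *m A *m E = E by rewrite EE !mulmxA D1.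
have AEj j : A ^+ j.+1 *m E ^+ j.+1 = P.
  elim: j => [|j IHj]; first by rewrite !expr1.
  have PEj : P *m E ^+ j.+1 = E ^+ j.+1 by rewrite exprS -mulmxE mulmxA PE.
  by rewrite exprSr (exprS E) -!mulmxE -mulmxA (mulmxA A) AE PEj.
pose W := weakgroup m A.
have AW : A ^+ m.+1 *m W = P *m A ^+ m.
  by rewrite /W /weakgroup -/E mulmxA AEj.
have WAW : W *m A *m W = W.
  have AmA : A ^+ m *m A = A ^+ m.+1 by rewrite mulmxE -exprSr.
  have EPm : E ^+ m.+1 *m P = E ^+ m.+1 by rewrite exprSr -mulmxE -mulmxA EP.
  rewrite {1}/W /weakgroup -/E -(mulmxA _ (A ^+ m)) AmA -mulmxA AW.
  by rewrite mulmxA EPm.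
have DAW : D *m A *m W = W.
  have DAEm : D *m A *m E ^+ m.+1 = E ^+ m.+1.
    by rewrite exprS -mulmxE (mulmxA _ E) DAE.
  by rewrite /W /weakgroup -/E mulmxA DAEm.
have AMA Z : Z *m A *m mpinv A *m A = Z *m A by rewrite -!mulmxA (mulmxA A) M1.
exists (D *m (A *m W *m A) *m mpinv A); rewrite /is_wgmp -/W -/D.
clearbody W; have -> : D *m (A *m W *m A) = W *m A by rewrite !mulmxA DAW.
by rewrite !mulmxA !AMA WAW !eqxx.
Qed.

Definition wgmp m A : 'M[C]_n := xchoose (wgmp_exists m A).

End Inverses.

(* Main.v *)
Require Import Defs.
From mathcomp Require Import all_boot all_order all_algebra.
From mathcomp Require Import complex reals.

Import GRing.Theory Num.Theory.
Local Open Scope ring_scope.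
Local Open Scope complex_scope.
Local Open Scope sesquilinear_scope.

(** The [m]-WGMP inverse is the only solution of its three defining equations,
    so the first formula only needs a check that [W P_A], with
    [W = weakgroup m A], is a solution.  Of [W] this uses two facts: the range
    of [W] lies in that of [A^D], so that [A^D A W = W], and [W A W = W].

    For the block formula write [A = U B U^*] with
    [B = [T S; 0 N]], and compute the two factors of [W P_A] separately.

    - The orthogonal projector onto the range of a matrix [M] is the only
      hermitian [P] with [P M = M] and [P = M Z] for some [Z]
      ([orthproj_char]); this determines projectors without computing any
      Moore-Penrose inverse.  As [T] is invertible, the range of [B] is the
      direct sum of the whole first summand and the range of [N], whence
      [P_A = U diag(1, N N^+) U^*] ([orthproj_core_block]).

    - Since [N^k = 0], each power [B^j] with [j >= k] has its second row of
      blocks equal to zero and [T^j] in its corner, so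
      [P_(A^k) = U diag(1, 0) U^*]. Writing this projector as [A^(k+1) Z] gives
      [A^cEP = A^D A^(k+1) Z = A^k Z] by the index equation of the Drazin
      inverse ([coreEP_char]), that is, [A^cEP = U diag(T^-1, 0) U^*]
      ([coreEP_core_block]).

    As [T_m] is exactly the off-diagonal block of [B^m] ([block_triu_pow]), the
    first row of blocks of [W = (A^cEP)^(m+1) A^m] is
    [T^-1, T^-(m+1) T_m], and multiplying by [P_A] gives the claim. *)

(** * Drazin and Moore-Penrose inverses *)

Lemma drazinP (F : fieldType) (n : nat) (A : 'M[F]_n) :
  [/\ drazin A *m A *m drazin A = drazin A, A *m drazin A = drazin A *m A
    & drazin A *m A ^+ (mxindex A).+1 = A ^+ mxindex A].
Proof. by have /and3P[/eqP ? /eqP ? /eqP ?] := xchooseP (drazin_exists A). Qed.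

Lemma mpinvP (C : numClosedFieldType) (m n : nat) (A : 'M[C]_(m, n)) :
  [/\ A *m mpinv A *m A = A, mpinv A *m A *m mpinv A = mpinv A,
      (A *m mpinv A)^t* = A *m mpinv A & (mpinv A *m A)^t* = mpinv A *m A].
Proof.
by have /and4P[/eqP ? /eqP ? /eqP ? /eqP ?] := xchooseP (mpinv_exists A).
Qed.

(** Both [P] and [A A^+] fix the range of [A] and map into it, so each absorbs
    the other on its right; taking adjoints makes them equal. *)
Lemma orthproj_char (C : numClosedFieldType) (n : nat) (A P Z : 'M[C]_n) :
  P^t* = P -> P *m A = A -> P = A *m Z -> orthproj A = P.
Proof.
move=> Pherm PA PZ; have [AXA _ Qherm _] := mpinvP _ _ _ A.
have QP : orthproj A *m P = P by rewrite PZ mulmxA AXA.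
have PQ : P *m orthproj A = orthproj A by rewrite mulmxA PA.
by rewrite -[LHS]PQ -Pherm -[orthproj A]Qherm -trCmx_mul QP.
Qed.

(** The equation [A^D A^(k+1) = A^k] trades the Drazin inverse in
    [A^cEP = A^D P_(A^k)] for one factor [A] of a factorization of the
    projector, so that [A^cEP] can be read off without knowing [A^D]. *)
Lemma coreEP_char (C : numClosedFieldType) (n : nat) (A Z : 'M[C]_n) :
  orthproj (A ^+ mxindex A) = A ^+ (mxindex A).+1 *m Z ->
  coreEP A = A ^+ mxindex A *m Z.
Proof.
have [_ _ D3] := drazinP _ _ A => PZ.
by rewrite /coreEP -mulmxA -/(orthproj _) PZ mulmxA D3.
Qed.

(** * The first formula *)

Lemma drazin_mul_coreEP (C : numClosedFieldType) (n : nat) (A : 'M[C]_n) :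
  drazin A *m A *m coreEP A = coreEP A.
Proof. by have [D1 _ _] := drazinP _ _ A; rewrite /coreEP !mulmxA D1. Qed.

Lemma drazin_mul_weakgroup (C : numClosedFieldType) (n m : nat) (A : 'M[C]_n) :
  drazin A *m A *m weakgroup m A = weakgroup m A.
Proof.
by rewrite /weakgroup exprS -mulmxE 2!(mulmxA (_ *m A)) drazin_mul_coreEP.
Qed.

(** The powers of [A] and [A^cEP] telescope because [A A^cEP = P_(A^k)] and
    [P_(A^k)] acts as the identity on either side of [A^cEP]. *)
Lemma weakgroup_outer (C : numClosedFieldType) (n m : nat) (A : 'M[C]_n) :
  weakgroup m A *m A *m weakgroup m A = weakgroup m A.
Proof.
have [_] := drazinP _ _ A; set k := mxindex A; pose D : 'M[C]_n := drazin A.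
rewrite -/D => DC D3; have [BXB _ _ _] := mpinvP _ _ _ (A ^+ k).
pose P := A ^+ k *m mpinv (A ^+ k).
have EE : coreEP A = D *m P by rewrite /P mulmxA.
have DAk : D *m A ^+ k = A ^+ k *m D by exact/commrX/esym.
have AE : A *m coreEP A = P.
  by rewrite EE mulmxA DC /P mulmxA -(mulmxA D) mulmxE -exprS -mulmxE D3.
have PE : P *m coreEP A = coreEP A.
  by rewrite EE /P !(mulmxA D) DAk !mulmxA BXB.
have EP : coreEP A *m P = coreEP A.
  by rewrite EE -mulmxA (mulmxA P) BXB.
have AEj j : A ^+ j.+1 *m coreEP A ^+ j.+1 = P.
  elim: j => [|j IHj]; first by rewrite !expr1.
  have PEj : P *m coreEP A ^+ j.+1 = coreEP A ^+ j.+1.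
    by rewrite exprS -mulmxE mulmxA PE.
  by rewrite exprSr (exprS (coreEP A)) -!mulmxE -mulmxA (mulmxA A) AE PEj.
have AmA : A ^+ m *m A = A ^+ m.+1 by rewrite mulmxE -exprSr.
have EPm : coreEP A ^+ m.+1 *m P = coreEP A ^+ m.+1.
  by rewrite exprSr -mulmxE -mulmxA EP.
rewrite {1}/weakgroup -(mulmxA _ (A ^+ m)) AmA -mulmxA /weakgroup.
by rewrite (mulmxA (A ^+ m.+1)) AEj mulmxA EPm.
Qed.

Lemma wgmpE (C : numClosedFieldType) (n m : nat) (A : 'M[C]_n) :
  wgmp m A = weakgroup m A *m orthproj A.
Proof.
apply: (@wgmp_unique _ _ m A); first exact: (xchooseP (wgmp_exists m A)).
have [AXA _ _ _] := mpinvP _ _ _ A.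
have WAXA : weakgroup m A *m orthproj A *m A = weakgroup m A *m A.
  by rewrite -mulmxA AXA.
apply/and3P; split; apply/eqP.
- by rewrite WAXA mulmxA weakgroup_outer.
- by rewrite !mulmxA.
- by rewrite WAXA 2!(mulmxA (drazin A)) drazin_mul_weakgroup.
Qed.

(** * Block triangular matrices and unitary conjugation *)

(** The off-diagonal blocks satisfy [T_(j+1) = S N^j + T T_j], and the sum
    does too: its first term is [S N^j], and [T] factors out of the others. *)
Lemma block_triu_pow (F : fieldType) (t s j : nat) (T : 'M[F]_t)
    (S : 'M[F]_(t, s)) (N : 'M[F]_s) :
  block_mx T S 0 N ^+ j =
  block_mx (T ^+ j) (\sum_(i < j) T ^+ i *m S *m N ^+ (j - 1 - i)) 0 (N ^+ j).
Proof.
elim: j => [|j IHj]; first by rewrite big_ord0 !expr0 -scalar_mx_block.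
rewrite exprS IHj -mulmxE mulmx_block !mul0mx !mulmx0 !addr0 add0r.
rewrite !mulmxE -!exprS; congr block_mx.
rewrite big_ord_recl expr0 mul1mx subSS !subn0 addrC mulmx_sumr.
congr (_ + _); apply: eq_bigr => i _.
by rewrite !mulmxA mulmxE -exprS /= /bump /= subnDA.
Qed.

Lemma unitary_conj_mul (C : numClosedFieldType) (n : nat) (U X Y : 'M[C]_n) :
  U \is unitarymx ->
  (U *m X *m U^t*) *m (U *m Y *m U^t*) = U *m (X *m Y) *m U^t*.
Proof.
move=> /unitarymxP /mulmx1C UU.
by rewrite !mulmxA -(mulmxA (U *m X)) UU mulmx1.
Qed.

Lemma unitary_conj_exp (C : numClosedFieldType) (n j : nat) (U X : 'M[C]_n) :
  U \is unitarymx -> (U *m X *m U^t*) ^+ j = U *m X ^+ j *m U^t*.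
Proof.
move=> uU; elim: j => [|j IHj].
  by rewrite !expr0 mulmx1; apply/esym/unitarymxP.
by rewrite !exprS IHj -!mulmxE unitary_conj_mul.
Qed.

Lemma unitary_conj_herm (C : numClosedFieldType) (n : nat) (U X : 'M[C]_n) :
  X^t* = X -> (U *m X *m U^t*)^t* = U *m X *m U^t*.
Proof. by move=> hX; rewrite !trCmx_mul trmxCK hX mulmxA. Qed.

Lemma block_diag_herm (C : numClosedFieldType) (t s : nat) (X : 'M[C]_t)
    (Y : 'M[C]_s) :
  X^t* = X -> Y^t* = Y ->
  (block_mx X 0 0 Y)^t* = block_mx X 0 0 Y.
Proof.
by move=> hX hY; rewrite tr_block_mx map_block_mx hX hY !trmx0 !map_mx0.
Qed.

(** * The core-EP decomposition *)

Lemma orthproj_core_block (C : numClosedFieldType) (t s : nat)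
    (U : 'M[C]_(t + s)) (T : 'M[C]_t) (S : 'M[C]_(t, s)) (N : 'M[C]_s) :
  U \is unitarymx -> T \in unitmx ->
  orthproj (U *m block_mx T S 0 N *m U^t*) =
  U *m block_mx 1%:M 0 0 (orthproj N) *m U^t*.
Proof.
move=> uU uT; have [NXN _ Nherm _] := mpinvP _ _ _ N.
(* The witness solves [T S; 0 N] Z = diag(1, N N^+) by back substitution. *)
pose Z := block_mx (invmx T) (- (invmx T *m S *m mpinv N)) 0 (mpinv N).
apply: (@orthproj_char _ _ _ _ (U *m Z *m U^t*)).
- apply: unitary_conj_herm; apply: block_diag_herm => //.
  by rewrite trmx1 map_mx1.
- rewrite unitary_conj_mul // mulmx_block !mul0mx !mulmx0 !mul1mx.
  by rewrite !addr0 !add0r NXN.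
- rewrite unitary_conj_mul // mulmx_block !mul0mx !mulmx0 !addr0 !add0r.
  by rewrite mulmxV // mulmxN !mulmxA mulmxV // mul1mx addNr.
Qed.

Lemma coreEP_core_block (C : numClosedFieldType) (t s : nat)
    (U : 'M[C]_(t + s)) (T : 'M[C]_t) (S : 'M[C]_(t, s)) (N : 'M[C]_s) :
  let A := U *m block_mx T S 0 N *m U^t* in
  U \is unitarymx -> T \in unitmx -> N ^+ mxindex A = 0 ->
  coreEP A = U *m block_mx (invmx T) 0 0 0 *m U^t*.
Proof.
move=> A uU uT; set k := mxindex A => Nk.
have Nk1 : N ^+ k.+1 = 0 by rewrite exprS Nk mulr0.
have uTj j : T ^+ j \in unitmx.
  elim: j => [|j IHj]; first by rewrite expr0 unitmx1.
  by rewrite exprS -mulmxE unitmx_mul uT.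
have Apow j : A ^+ j = U *m block_mx T S 0 N ^+ j *m U^t*.
  exact: unitary_conj_exp.
have AZ j (Y : 'M[C]_t) : N ^+ j = 0 ->
    A ^+ j *m (U *m block_mx Y 0 0 0 *m U^t*) =
    U *m block_mx (T ^+ j *m Y) 0 0 0 *m U^t*.
  move=> Nj; rewrite Apow unitary_conj_mul // block_triu_pow Nj mulmx_block.
  by rewrite !mulmx0 !mul0mx !addr0.
rewrite (@coreEP_char _ _ _ (U *m block_mx (invmx (T ^+ k.+1)) 0 0 0 *m U^t*)).
  rewrite AZ //; congr (_ *m block_mx _ 0 0 0 *m _).
  apply: (can_inj (mulKmx uT)).
  by rewrite mulmxA mulmxE -exprS -mulmxE !mulmxV.
rewrite AZ // mulmxV //.
apply: (@orthproj_char _ _ _ _ (U *m block_mx (invmx (T ^+ k)) 0 0 0 *m U^t*)).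
- apply: unitary_conj_herm; apply: block_diag_herm.
    by rewrite trmx1 map_mx1.
  by rewrite trmx0 map_mx0.
- rewrite Apow unitary_conj_mul // block_triu_pow Nk mulmx_block.
  by rewrite !mul0mx !mul1mx !addr0.
- by rewrite AZ // mulmxV.
Qed.

Lemma wgmp_core_block (C : numClosedFieldType) (m t s : nat)
    (U : 'M[C]_(t + s)) (T : 'M[C]_t) (S : 'M[C]_(t, s)) (N : 'M[C]_s) :
  let A := U *m block_mx T S 0 N *m U^t* in
  let Tm := \sum_(j < m) T ^+ j *m S *m N ^+ (m - 1 - j) in
  U \is unitarymx -> T \in unitmx -> N ^+ mxindex A = 0 ->
  wgmp m A =
  U *m block_mx (invmx T) (invmx T ^+ m.+1 *m Tm *m N *m mpinv N) 0 0 *m U^t*.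
Proof.
move=> A Tm uU uT Nk; rewrite wgmpE orthproj_core_block //.
rewrite /weakgroup coreEP_core_block // !unitary_conj_exp // !unitary_conj_mul //.
have -> : block_mx (invmx T) 0 0 0 ^+ m.+1 =
    block_mx (invmx T ^+ m.+1) 0 0 (0 : 'M[C]_s).
  rewrite block_triu_pow big1 ?expr0n // => i _.
  by rewrite mulmx0 mul0mx.
have TT : invmx T ^+ m.+1 *m T ^+ m = invmx T.
  elim: {Tm} m => [|j IHj]; first by rewrite expr1 expr0 mulmx1.
  rewrite exprSr (exprS T) -!mulmxE mulmxA -(mulmxA _ (invmx T)) mulVmx //.
  by rewrite mulmx1.
rewrite block_triu_pow -/Tm !mulmx_block !mul0mx !mulmx0 !addr0 !add0r TT mulmx1.
by rewrite !mul0mx /orthproj !mulmxA.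
Qed.

Theorem theorem3p6 (R : realType) (n k m : nat) (A : 'M[R[i]]_n) :
  mxindex A = k -> (0 < m)%N ->
  wgmp m A = weakgroup m A *m orthproj A /\
  forall (t s : nat) (e : (t + s)%N = n) (U : 'M[R[i]]_n)
    (T : 'M[R[i]]_t) (S : 'M[R[i]]_(t, s)) (N : 'M[R[i]]_s),
    U \is unitarymx -> T \in unitmx -> \rank (A ^+ k) = t ->
    nilpotent_of_index N k ->
    A = U *m castmx (e, e) (block_mx T S 0 N) *m U^t* ->
    let Tm := \sum_(j < m) T ^+ j *m S *m N ^+ (m - 1 - j) in
    wgmp m A =
      U *m castmx (e, e)
        (block_mx (invmx T) (invmx T ^+ m.+1 *m Tm *m N *m mpinv N) 0 0)
        *m U^t*.
Proof.
move=> kE _; split=> [|t s e U T S N uU uT _ [Nk _] AE Tm]; first exact: wgmpE.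
subst n; rewrite castmx_id in AE; rewrite castmx_id.
by subst A k; apply: wgmp_core_block.
Qed.
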